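(* Let $0<p\le 1$ and let $\mathcal{B}=(e_n)_{n=1}^\infty$ be a basis of a $p$-Banach space $\mathbb{X}$. The following statements are equivalent: (i) $\mathcal{B}$ is almost greedy. (ii) There is $\mathbf{C}\ge 1$ such that $$\|x-G_m(x)\|\ \le\ \mathbf{C}\,\check{\sigma}_k(x)$$ for all $x\in\mathbb{X}$, all $m\in\mathbb{N}$, all greedy sums $G_m(x)$ of $x$ of order $m$, and all integers $0\le k\le m$. (iii) $\mathcal{B}$ is consecutive almost greedy. Moreover, if $p=1$ and $\mathcal{B}$ is $1$-consecutive almost greedy, then $\mathcal{B}$ is $1$-almost greedy.
   Context: Spaces are separable and infinite-dimensional over $\mathbb{F}=\mathbb{R}$ or $\mathbb{C}$. A $p$-Banach space ($0<p\le 1$) is a vector space complete with respect to a $p$-norm $\|\cdot\|$, i.e. $\|x\|\ge 0$ with equality iff $x=0$, $\|ax\|=|a|\|x\|$ for scalars $a$, and $\|x+y\|^p\le\|x\|^p+\|y\|^p$. (For $p=1$ this is a Banach space.) Basis: a collection $\mathcal{B}=(e_n)_{n=1}^\infty\subset\mathbb{X}$ is a (semi-normalized) basis if (1) the closed linear span of $(e_n)$ is $\mathbb{X}$; (2) there is a unique sequence $(e_n^* )_{n=1}^\infty\subset\mathbb{X}^*$ with $e_j^*(e_k)=\delta_{j,k}$ for all $j,k$; (3) $0<\inf_n\{\|e_n\|,\|e_n^*\|\}\le\sup_n\{\|e_n\|,\|e_n^*\|\}<\infty$. For a finite set $A\subset\mathbb{N}$, $P_A(x):=\sum_{n\in A}e_n^*(x)e_n$.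 A set $A\subset\mathbb{N}$ is an $m$-greedy set of $x$ if $|A|=m$ and $\min_{n\in A}|e_n^*(x)|\ge\max_{n\notin A}|e_n^*(x)|$; the corresponding greedy sum of order $m$ is $G_m(x):=P_A(x)$. Greedy sets and sums need not be unique; ''for all $G_m(x)$'' means for all greedy sums of order $m$. $\tilde{\sigma}_m(x):=\inf\{\|x-P_A(x)\|: A\subset\mathbb{N},\ |A|=m\}$. The basis is $\mathbf{C}$-almost greedy ($\mathbf{C}\ge1$) if $\|x-G_m(x)\|\le\mathbf{C}\,\tilde{\sigma}_m(x)$ for all $x\in\mathbb{X}$, $m\in\mathbb{N}$ and all $G_m(x)$; it is almost greedy if it is $\mathbf{C}$-almost greedy for some $\mathbf{C}\ge1$. An interval is a finite set of consecutive natural numbers (the empty set included), and $\mathcal{I}$ is the set of all intervals. For integers $m\ge0$, $\check{\sigma}_m(x):=\inf\{\|x-P_I(x)\|: I\in\mathcal{I},\ |I|=m\}$ (so $\check\sigma_0(x)=\|x\|$). The basis is $\mathbf{C}$-consecutive almost greedy ($\mathbf{C}\ge1$) if $\|x-G_m(x)\|\le\mathbf{C}\,\check{\sigma}_m(x)$ for all $x\in\mathbb{X}$, $m\in\mathbb{N}$ and all $G_m(x)$; it is consecutive almost greedy if this holds for some $\mathbf{C}\ge1$. *)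

(* Defs.v *)
From mathcomp Require Import all_boot all_order all_algebra finmap.
From mathcomp Require Import all_classical all_reals all_analysis.
From mathcomp Require Import complex.

Set Implicit Arguments.
Unset Strict Implicit.
Unset Printing Implicit Defensive.

Import Order.TTheory GRing.Theory Num.Theory.
Local Open Scope fset_scope.
Local Open Scope classical_set_scope.
Local Open Scope ring_scope.

Variant scalar_kind := RealScalars | ComplexScalars.

Definition scalars (R : realType) (s : scalar_kind) : numFieldType :=
  match s with
  | RealScalars => R
  | ComplexScalars => R[i]%C
  end.

(* The norm `|z| of R[i] lives in R[i]; Normc.normc is its R-valued version. *)
Definition modulus (R : realType) (s : scalar_kind) : scalars R s -> R :=
  match s with
  | RealScalars => fun a : R => `|a|
  | ComplexScalars => fun z : R[i]%C => Normc.normc z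
  end.

Record p_norm (R : realType) (s : scalar_kind) (p : R)
    (X : lmodType (scalars R s)) (nrm : X -> R) : Prop := {
  p_norm_ge0 : forall x, 0 <= nrm x;
  p_norm_eq0 : forall x, nrm x = 0 <-> x = 0;
  p_normZ : forall a x, nrm (a *: x) = modulus a * nrm x;
  p_normD : forall x y, nrm (x + y) `^ p <= nrm x `^ p + nrm y `^ p
}.

Definition complete_norm (R : realType) (V : zmodType) (nrm : V -> R) : Prop :=
  forall u : nat -> V,
    (forall eps : R, 0 < eps -> exists N : nat, forall i j : nat,
        (N <= i)%N -> (N <= j)%N -> nrm (u i - u j) < eps) ->
    exists l : V, forall eps : R, 0 < eps -> exists N : nat,
      forall i : nat, (N <= i)%N -> nrm (u i - l) < eps.

Definition separable_norm (R : realType) (V : zmodType) (nrm : V -> R) : Prop :=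
  exists u : nat -> V, forall x (eps : R), 0 < eps ->
    exists n, nrm (x - u n) < eps.

Definition infinite_dimensional (F : numFieldType) (V : lmodType F) : Prop :=
  forall n (v : 'I_n -> V), exists x : V, forall a : 'I_n -> F,
    x <> \sum_(i < n) a i *: v i.

Record p_Banach (R : realType) (s : scalar_kind) (p : R)
    (X : lmodType (scalars R s)) (nrm : X -> R) : Prop := {
  p_Banach_norm : p_norm p nrm;
  p_Banach_complete : complete_norm nrm;
  p_Banach_separable : separable_norm nrm;
  p_Banach_infinite_dim : infinite_dimensional X
}.

(* The topological dual: a linear functional on a p-normed space is continuous
   if and only if it is bounded, i.e. has finite dual norm. *)
Definition dual_norm (R : realType) (s : scalar_kind)
    (X : lmodType (scalars R s)) (nrm : X -> R) (f : {scalar X}) : \bar R :=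
  ereal_sup [set (modulus (f x))%:E | x in [set x : X | nrm x <= 1]].

Definition in_dual (R : realType) (s : scalar_kind)
    (X : lmodType (scalars R s)) (nrm : X -> R) (f : {scalar X}) : Prop :=
  (dual_norm nrm f < +oo)%E.

Definition biorthogonal (F : numFieldType) (X : lmodType F)
    (e : nat -> X) (es : nat -> {scalar X}) : Prop :=
  forall j k : nat, es j (e k) = (j == k)%:R.

(* Sequences are indexed from 0: e n stands for e_{n+1}. *)
Record is_basis (R : realType) (s : scalar_kind)
    (X : lmodType (scalars R s)) (nrm : X -> R)
    (e : nat -> X) (es : nat -> {scalar X}) : Prop := {
  basis_span : forall x (eps : R), 0 < eps ->
    exists n (a : nat -> scalars R s),
      nrm (x - \sum_(i < n) a i *: e i) < eps;
  basis_dual : forall n, in_dual nrm (es n);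
  basis_biorthogonal : biorthogonal e es;
  basis_unique : forall fs : nat -> {scalar X},
    (forall n, in_dual nrm (fs n)) -> biorthogonal e fs ->
    forall n x, fs n x = es n x;
  basis_inf : (0 < ereal_inf (range (fun n => (nrm (e n))%:E) `|`
                              range (fun n => dual_norm nrm (es n))))%E;
  basis_sup : (ereal_sup (range (fun n => (nrm (e n))%:E) `|`
                          range (fun n => dual_norm nrm (es n))) < +oo)%E
}.

Definition coord_proj (F : numFieldType) (X : lmodType F)
    (e : nat -> X) (es : nat -> {scalar X}) (A : {fset nat}) (x : X) : X :=
  \sum_(n <- A) es n x *: e n.

Definition greedy_set (R : realType) (s : scalar_kind)
    (X : lmodType (scalars R s)) (es : nat -> {scalar X})
    (x : X) (m : nat) (A : {fset nat}) : Prop :=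
  #|` A| = m /\
  forall i j : nat, i \in A -> j \notin A ->
    modulus (es j x) <= modulus (es i x).

Definition is_interval (A : {fset nat}) : Prop :=
  exists a n : nat, A = [fset i | i in iota a n].

Definition sigma_tilde (R : realType) (F : numFieldType) (X : lmodType F)
    (nrm : X -> R) (e : nat -> X) (es : nat -> {scalar X})
    (m : nat) (x : X) : R :=
  inf [set nrm (x - coord_proj e es A x) | A in [set A : {fset nat} | #|` A| = m]].

Definition sigma_check (R : realType) (F : numFieldType) (X : lmodType F)
    (nrm : X -> R) (e : nat -> X) (es : nat -> {scalar X})
    (m : nat) (x : X) : R :=
  inf [set nrm (x - coord_proj e es A x) |
        A in [set A : {fset nat} | is_interval A /\ #|` A| = m]].

Definition C_almost_greedy (R : realType) (s : scalar_kind)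
    (X : lmodType (scalars R s)) (nrm : X -> R)
    (e : nat -> X) (es : nat -> {scalar X}) (C : R) : Prop :=
  1 <= C /\
  forall (x : X) (m : nat), (0 < m)%N ->
  forall A : {fset nat}, greedy_set es x m A ->
    nrm (x - coord_proj e es A x) <= C * sigma_tilde nrm e es m x.

Definition almost_greedy (R : realType) (s : scalar_kind)
    (X : lmodType (scalars R s)) (nrm : X -> R)
    (e : nat -> X) (es : nat -> {scalar X}) : Prop :=
  exists C : R, C_almost_greedy nrm e es C.

Definition C_consecutive_almost_greedy (R : realType) (s : scalar_kind)
    (X : lmodType (scalars R s)) (nrm : X -> R)
    (e : nat -> X) (es : nat -> {scalar X}) (C : R) : Prop :=
  1 <= C /\
  forall (x : X) (m : nat), (0 < m)%N ->
  forall A : {fset nat}, greedy_set es x m A ->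
    nrm (x - coord_proj e es A x) <= C * sigma_check nrm e es m x.

Definition consecutive_almost_greedy (R : realType) (s : scalar_kind)
    (X : lmodType (scalars R s)) (nrm : X -> R)
    (e : nat -> X) (es : nat -> {scalar X}) : Prop :=
  exists C : R, C_consecutive_almost_greedy nrm e es C.

(* Main.v *)
Require Import Defs.
From mathcomp Require Import all_boot all_order all_algebra finmap.
From mathcomp Require Import all_classical all_reals all_analysis.
From mathcomp Require Import complex.
From mathcomp Require Import ring lra.

Set Implicit Arguments.
Unset Strict Implicit.
Unset Printing Implicit Defensive.

Import Order.TTheory GRing.Theory Num.Theory.
Local Open Scope ring_scope.

(** Throughout, K = 2^(1/p) is the constant of the triangle inequality
    |x + y| <= K (|x| + |y|), a consequence of the p-triangle inequality
    ([quasi_triangle]).  The coefficients e_n^*(x) tend to 0, so an interval D of any given size can be pushed so far that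
    |x - P_D x| <= 2K |x| ([far_residual]); comparing with a far interval thus
    amounts to comparing with |x|.

    Almost greedy implies the bound for all sizes k <= m: given B with
    |B| = k <= m and a greedy set A, let D consist of the m - k largest
    coefficients of x on A minus B.  Then D is a greedy set of x - P_B x, so
    removing it costs only a constant, while B together with D has the size m
    for which almost greediness compares it with A
    ([almost_greedy_residual]).

    Consecutive almost greedy implies almost greedy: the task is to compare
    x - P_A x with u = x - P_B x when |A| = |B| and A is greedy; the two differ
    by P_{A-B} x and P_{B-A} x.  Let c be the smallest coefficient of x on A-B
    and D a far interval of size |A-B|.  Three facts give the bound
    ([block_dominated_residual]).
    - P_{A-B} can be dropped from u, since A-B is greedy there and D is an
      interval carrying almost nothing.
    - After adding c 1_D to u, the greedy set A-B may be exchanged for the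
      interval D; hence |c 1_D| is bounded by a multiple of |u|.
    - |P_{B-A} x| <= C |c 1_D| ([spread_bound]).  This is the heart of the
      proof: B-A need not be an interval, but if J is an interval containing it, the
      vector P_{B-A} x + c 1_{J-(B-A)} + c 1_D has the greedy set
      (J-(B-A)) + D, of the same size as J.  Removing the greedy set leaves
      P_{B-A} x, removing J leaves c 1_D.

    With constant 1, B can be turned into A one element at a time, exchanging
    some b in B-A for the largest coefficient on A-B: each exchange is the
    case m = 1 of the hypothesis, singletons being intervals, and does not
    increase the norm of the residual ([isometric_residual]). *)

(** * The modulus of a scalar *)

Section Modulus.
Variables (R : realType) (s : scalar_kind).
Implicit Types a b : scalars R s.

Lemma modulus_ge0 a : 0 <= modulus a.
Proof.
case: s a => [a|[u v]] /=; first exact: normr_ge0.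
exact: sqrtr_ge0.
Qed.

Lemma modulusM a b : modulus (a * b) = modulus a * modulus b.
Proof. by case: s a b => [a b|a b] /=; [exact: normrM | exact: Normc.normcM]. Qed.

Lemma modulus0 : modulus (0 : scalars R s) = 0.
Proof. by case: s => /=; [exact: normr0 | exact: Normc.normc0]. Qed.

Lemma modulus0_le a : modulus (0 : scalars R s) <= modulus a.
Proof. by rewrite modulus0 modulus_ge0. Qed.

Lemma modulusN1 : modulus (-1 : scalars R s) = 1.
Proof.
case: s => /=; first exact: normrN1.
exact: etrans (normcN (1 : R[i]%C)) (Normc.normc1 R).
Qed.

Lemma modulus_natr n : modulus (n%:R : scalars R s) = n%:R.
Proof.
case: s => /=; first exact: normr_nat.
have := normcMn (1 : R[i]%C) n; rewrite Normc.normc1; exact.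
Qed.

End Modulus.

(** * The quasi-triangle inequality *)

(** Each of the two norms is at most their sum t, so |x+y|^p <= 2 t^p; take
    p-th roots. *)
Lemma quasi_triangle (R : realType) (s : scalar_kind) (p : R)
    (X : lmodType (scalars R s)) (nrm : X -> R) :
  0 < p -> p_norm p nrm ->
  forall x y, nrm (x + y) <= 2 `^ p^-1 * (nrm x + nrm y).
Proof.
move=> p0 [n0 _ _ nD] x y.
have p1 : 0 <= p^-1 by rewrite invr_ge0 ltW.
have root z : 0 <= z -> (z `^ p) `^ p^-1 = z.
  by move=> z0; rewrite -powRrM divff ?gt_eqF // powRr1.
rewrite -[leLHS]root //.
set m := nrm x + nrm y.
have m0 : 0 <= m by rewrite addr_ge0.
rewrite -[X in _ * X]root // -powRM // ?powR_ge0 //.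
apply: ge0_ler_powR => //; rewrite ?nnegrE ?powR_ge0 ?mulr_ge0 ?powR_ge0 //.
apply: (le_trans (nD _ _)); rewrite mulrDl mul1r.
by apply: lerD; apply: ge0_ler_powR; rewrite ?nnegrE ?lerDl ?lerDr // ltW.
Qed.

(** * Finite sets of integers *)

Lemma block_card (a n : nat) : #|` [fset i | i in iota a n]%fset| = n.
Proof. by rewrite card_imfset //= undup_id ?iota_uniq // size_iota. Qed.

Lemma mem_block (a n i : nat) :
  (i \in [fset i | i in iota a n]%fset) = (a <= i < a + n)%N.
Proof.
apply/imfsetP/idP => /= [[j + ->]|]; first by rewrite mem_iota.
by exists i => //; rewrite mem_iota.
Qed.

Lemma cardfsU_disjoint (A B : {fset nat}) : [disjoint A & B]%fset ->
  #|` A `|` B|%fset = (#|` A| + #|` B|)%N.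
Proof. by move=> /eqP AB; rewrite cardfsU AB cardfs0 subn0. Qed.

Lemma fset_argmax (R : realType) (f : nat -> R) (S : {fset nat}) :
  S != fset0 -> exists2 a, a \in S & forall b, b \in S -> f b <= f a.
Proof.
case/fset0Pn => i iS.
have [j _ jmax] := @arg_maxP _ _ S [` iS]%fset xpredT (f \o val) isT.
exists (val j); first exact: valP.
by move=> b bS; exact: (jmax [` bS]%fset).
Qed.

Lemma fset_top (R : realType) (f : nat -> R) (S : {fset nat}) n :
  (n <= #|` S|)%N -> exists D : {fset nat},
    [/\ (D `<=` S)%fset, #|` D| = n &
        forall i j, i \in D -> j \in S -> j \notin D -> f j <= f i].
Proof.
elim: n => [|n IH] le_nS.
  by exists fset0; split; rewrite ?fsub0set ?cardfs0 // => i j; rewrite in_fset0.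
have [D [DS Dn Dtop]] := IH (ltnW le_nS).
have nz : (S `\` D)%fset != fset0.
  by rewrite -cardfs_gt0 cardfsDS // subn_gt0 Dn.
have [a aSD amax] := fset_argmax f nz.
move: aSD; rewrite inE => /andP[aD aS].
exists (a |` D)%fset; split.
- by rewrite fsubUset fsub1set aS.
- by rewrite cardfsU1 aD Dn.
- move=> i j; rewrite !inE negb_or => /orP[/eqP->|iD] jS /andP[ja jD].
    by apply: amax; rewrite inE jD.
  exact: Dtop.
Qed.

(** * Coordinate projections *)

Section Projections.
Variables (F : numFieldType) (X : lmodType F).
Variables (e : nat -> X) (es : nat -> {scalar X}).
Hypothesis bio : biorthogonal e es.
Local Notation P A x := (coord_proj e es A x).
Implicit Types (A B : {fset nat}) (x y : X) (a : nat -> F).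

Lemma coefZ c x j : es j (c *: x) = c * es j x.
Proof. by rewrite linearZ. Qed.

Lemma coefD x y j : es j (x + y) = es j x + es j y.
Proof. by rewrite raddfD. Qed.

Definition finite_sum a A : X := \sum_(n <- A) a n *: e n.

Lemma finite_sumU a {A B} : [disjoint A & B]%fset ->
  finite_sum a (A `|` B)%fset = finite_sum a A + finite_sum a B.
Proof.
move=> dAB; rewrite /finite_sum [LHS](big_fsetID _ (mem A)) /=; congr (_ + _).
  apply: eq_fbigl => i; rewrite !inE /=.
  by case: (i \in A); rewrite ?andbT ?andbF.
apply: eq_fbigl => i; rewrite !inE /=.
have [iA|] := boolP (i \in A); last by rewrite andbT.
by rewrite andbF; apply/esym/negbTE; move/fdisjointP: dAB; apply.
Qed.

Lemma coef_finite_sum a A j : es j (finite_sum a A) = if j \in A then a j else 0.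
Proof.
rewrite /finite_sum raddf_sum /=.
under eq_bigr do rewrite coefZ bio.
have [jA|jA] := ifP.
  rewrite (big_fsetD1 j) //= eqxx mulr1 big_seq big1 ?addr0 // => i.
  by rewrite !inE => /andP[ij _]; rewrite eq_sym (negbTE ij) mulr0.
rewrite big_seq big1 // => i iA.
by case: eqP => [ji|_]; rewrite ?mulr0 //; move: jA; rewrite ji iA.
Qed.

Lemma coord_projE A x a : (forall n, n \in A -> es n x = a n) ->
  P A x = finite_sum a A.
Proof. by move=> xa; apply: eq_big_seq => n /xa ->. Qed.

Lemma eq_coord_proj A x y : (forall n, n \in A -> es n x = es n y) ->
  P A x = P A y.
Proof. exact: coord_projE. Qed.

Lemma coord_proj_eq0 A x : (forall n, n \in A -> es n x = 0) -> P A x = 0.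
Proof.
by move=> x0; rewrite /coord_proj big_seq big1 // => n /x0 ->; rewrite scale0r.
Qed.

Lemma coord_projU {A B} x : [disjoint A & B]%fset ->
  P (A `|` B)%fset x = P A x + P B x.
Proof. exact: finite_sumU. Qed.

Lemma coef_coord_proj A x j : es j (P A x) = if j \in A then es j x else 0.
Proof. exact: (coef_finite_sum (fun n => es n x)). Qed.

Lemma coef_residual A x j : es j (x - P A x) = if j \in A then 0 else es j x.
Proof.
by rewrite raddfB /= coef_coord_proj; case: ifP; rewrite ?subrr ?subr0.
Qed.

End Projections.

(** * Best approximation errors *)

Section Residuals.
Variables (R : realType) (F : numFieldType) (X : lmodType F) (nrm : X -> R).
Variables (e : nat -> X) (es : nat -> {scalar X}).
Hypothesis nrm_ge0 : forall x, 0 <= nrm x.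

(** The approximation errors by sets of size m and by intervals of size m are,
    up to conversion, the cases where [Q] is the family of these sets. *)
Definition inf_residual (Q : set {fset nat}) (x : X) : R :=
  inf [set nrm (x - coord_proj e es A x) | A in Q].

Lemma inf_residual_le (Q : set {fset nat}) A x :
  Q A -> inf_residual Q x <= nrm (x - coord_proj e es A x).
Proof.
move=> QA; apply: ge_inf; last by exists A.
by exists 0 => _ [B _ <-].
Qed.

Lemma le_inf_residual (Q : set {fset nat}) A0 x (C r : R) : 0 < C -> Q A0 ->
  (forall A, Q A -> r <= C * nrm (x - coord_proj e es A x)) ->
  r <= C * inf_residual Q x.
Proof.
move=> C0 QA0 Qr; rewrite -ler_pdivrMl //; apply: lb_le_inf.
  by exists (nrm (x - coord_proj e es A0 x)); exists A0.
by move=> _ [A QA <-]; rewrite ler_pdivrMl //; exact: Qr.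
Qed.

End Residuals.

(** * Bases of p-normed spaces *)

Section Basis.
Variables (R : realType) (s : scalar_kind) (p : R) (p_gt0 : 0 < p).
Variables (X : lmodType (scalars R s)) (nrm : X -> R).
Variables (e : nat -> X) (es : nat -> {scalar X}).
Hypotheses (hX : p_norm p nrm) (hB : is_basis nrm e es).
Local Notation P A x := (coord_proj e es A x).
Local Notation K := (2 `^ p^-1 : R).
Local Notation block a n := [fset i | i in iota a n]%fset.

Let bio : biorthogonal e es := basis_biorthogonal hB.
Let nrm_ge0 := p_norm_ge0 hX.
Let nrmZ := p_normZ hX.

Let nrm0 : nrm 0 = 0.
Proof. exact/(p_norm_eq0 hX). Qed.

Let nrmN x : nrm (- x) = nrm x.
Proof. by rewrite -scaleN1r nrmZ modulusN1 mul1r. Qed.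

Let nrmD x y : nrm (x + y) <= K * (nrm x + nrm y).
Proof. exact: quasi_triangle. Qed.

Let nrmB x y : nrm (x - y) <= K * (nrm x + nrm y).
Proof. by rewrite -[nrm y]nrmN. Qed.

Let K_ge1 : 1 <= K.
Proof.
by rewrite -[leLHS](powRr0 2) ler_powR ?ler1n // invr_ge0 ltW.
Qed.

Let K_gt0 : 0 < K. Proof. exact: lt_le_trans K_ge1. Qed.

(** The constant may grow with the number of terms, as it is only applied to
    projections onto a fixed number of coordinates. *)
Lemma nrm_sum_le (r : seq nat) (v : nat -> X) (d : R) : 0 <= d ->
  (forall i, i \in r -> nrm (v i) <= d) ->
  nrm (\sum_(i <- r) v i) <= (2 * K) ^+ size r * d.
Proof.
move=> d0; elim: r => [|i r IH] vd; first by rewrite big_nil nrm0 mul1r.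
rewrite big_cons; apply: le_trans (nrmD _ _) _.
have L1 : 1 <= (2 * K) ^+ size r by rewrite exprn_ege1 //; have := K_ge1; lra.
have vi : nrm (v i) <= (2 * K) ^+ size r * d.
  by apply: le_trans (vd i (mem_head _ _)) _; rewrite ler_peMl.
have := IH (fun j jr => vd j (@mem_behead _ (i :: r) j jr)).
rewrite /= exprS => vr.
have -> : 2 * K * (2 * K) ^+ size r * d =
  K * ((2 * K) ^+ size r * d + (2 * K) ^+ size r * d) by ring.
by rewrite ler_pM2l // lerD.
Qed.

Lemma basis_bounded : exists2 M : R, 0 < M &
  (forall n, nrm (e n) <= M) /\
  (forall n x, nrm x <= 1 -> modulus (es n x) <= M).
Proof.
have := basis_sup hB; set S := ereal_sup _ => S_fin.
have e_le n : ((nrm (e n))%:E <= S)%E.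
  by apply: ereal_sup_ubound; left; exists n.
have es_le n : (dual_norm nrm (es n) <= S)%E.
  by apply: ereal_sup_ubound; right; exists n.
have S_num : S \is a fin_num.
  rewrite fin_numE; apply/andP; split; last by rewrite lt_eqF.
  by apply: contraTneq (e_le 0%N) => ->.
exists (fine S + 1).
  rewrite ltr_pwDr // -lee_fin fineK //.
  by apply: le_trans (e_le 0%N); rewrite lee_fin.
have leS r : (r%:E <= S)%E -> r <= fine S + 1.
  rewrite -{1}(fineK S_num) lee_fin => /le_trans; apply.
  by rewrite lerDl.
split=> [n|n x x1]; apply: leS; first exact: e_le.
apply: le_trans (es_le n); apply: ereal_sup_ubound.
by exists x.
Qed.

(** A finite combination v of the basis vectors within 1/q of x has no
    coefficients far out, and there those of x - v are at most M/q. *)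
Lemma coef_vanish x (eps : R) : 0 < eps ->
  exists N : nat, forall n, (N <= n)%N -> modulus (es n x) < eps.
Proof.
move=> eps0; have [M M0 [_ es_le]] := basis_bounded.
have [q qM] : exists q : nat, M / eps < q%:R.
  by exists (Num.bound (M / eps)); apply: archi_boundP; rewrite divr_ge0 // ltW.
have q0 : 0 < q%:R :> R by apply: le_lt_trans qM; rewrite divr_ge0 // ltW.
have [N [a]] := @basis_span _ _ _ _ _ _ hB x q%:R^-1 ltac:(by rewrite invr_gt0).
set v := \sum_(i < N) _ => xv.
exists N => n Nn.
have env : es n v = 0.
  rewrite raddf_sum big1 //= => i _; rewrite coefZ bio.
  by rewrite gtn_eqF ?mulr0 // (leq_trans (ltn_ord i)).
have /(es_le n) : nrm (q%:R *: (x - v)) <= 1.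
  by rewrite nrmZ modulus_natr -ler_pdivlMl // mulr1 ltW.
rewrite coefZ raddfB /= env subr0 modulusM modulus_natr => le_M.
rewrite -(ltr_pM2l q0); apply: le_lt_trans le_M _.
by rewrite -ltr_pdivrMr.
Qed.

(** Coefficients beyond N are so small that k of them contribute little; if
    x = 0 there is nothing to choose. *)
Lemma far_block k N x : exists2 a, (N <= a)%N & nrm (P (block a k) x) <= nrm x.
Proof.
have [M M0 [e_le _]] := basis_bounded.
have [x0|x0] := eqVneq (nrm x) 0.
  exists N => //; move/(p_norm_eq0 hX): x0 => ->.
  by rewrite coord_proj_eq0 // => n _; rewrite linear0.
have nx0 : 0 < nrm x by rewrite lt_def x0 nrm_ge0.
have L0 : 0 < (2 * K) ^+ k by rewrite exprn_gt0 // mulr_gt0.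
have [N1 small] := @coef_vanish x (nrm x / (2 * K) ^+ k / M)
  ltac:(by rewrite !divr_gt0).
exists (maxn N N1); first exact: leq_maxl.
have -> : nrm x = (2 * K) ^+ k * (nrm x / (2 * K) ^+ k).
  by rewrite mulrC divfK // gt_eqF.
set D := block _ _; have cD : #|` D| = k by exact: block_card.
rewrite -{1}cD /coord_proj; apply: nrm_sum_le => [|n nD].
  by rewrite divr_ge0 // ltW.
have : n \in D by [].
rewrite mem_block geq_max => /andP[/andP[_ /small sm] _].
rewrite nrmZ -[leRHS](divfK (lt0r_neq0 M0)) ler_pM ?modulus_ge0 //.
exact: ltW.
Qed.

Lemma far_residual k N x : exists2 a, (N <= a)%N &
  nrm (P (block a k) x) <= nrm x /\
  nrm (x - P (block a k) x) <= 2 * K * nrm x.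
Proof.
have [a Na Px] := far_block k N x; exists a => //; split=> //.
apply: le_trans (nrmB _ _) _; rewrite -mulrA [2 * _]mulrC -mulrA.
by rewrite ler_pM2l //; lra.
Qed.

Lemma block_bound (A : {fset nat}) : exists2 N, (0 < N)%N & (A `<=` block 0 N)%fset.
Proof.
exists (\max_(i <- A) i).+1 => //; apply/fsubsetP => i iA.
by rewrite mem_block add0n leq0n ltnS leq_bigmax_seq.
Qed.

Lemma coord_proj_swap (A B : {fset nat}) x :
  x - P A x = x - P B x - P (A `\` B)%fset x + P (B `\` A)%fset x.
Proof.
have split C D : P C x = P (C `&` D)%fset x + P (C `\` D)%fset x.
  rewrite -{1}(fsetID D C) coord_projU //.
  apply/fdisjointP => i; rewrite !inE => /andP[_ iD].
  by rewrite iD.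
rewrite [in LHS](split A B) [P B x](split B A) fsetIC.
by rewrite !opprD !addrA [RHS]addrAC subrK.
Qed.

(** * From almost greedy to smaller comparison sets *)

(** The comparison set [B] is filled up to size [m] with the largest
    coefficients of [x] on [A] minus [B].  Filling up is itself a greedy
    approximation of [x - P B x], hence costs a factor [C] times the [2 * K] of
    a comparison with a far interval; the remaining factor [C] compares [A] with
    a set of its own size. *)
Lemma almost_greedy_residual (C : R) x m A B :
  C_almost_greedy nrm e es C -> (0 < m)%N -> greedy_set es x m A ->
  (#|` B| <= m)%N ->
  nrm (x - P A x) <= C * (C * (2 * K)) * nrm (x - P B x).
Proof.
move=> [C1 agC] m0 gA Bm.
have C0 : 0 < C by exact: lt_le_trans C1.
have ag y n D E : greedy_set es y n D -> #|` E| = n -> (0 < n)%N ->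
    nrm (y - P D y) <= C * nrm (y - P E y).
  move=> gD En n0; apply: le_trans (agC _ _ n0 _ gD) _.
  by rewrite ler_pM2l //; apply: inf_residual_le.
have [cA Atop] := gA.
set y := x - P B x.
have le_AB : (m - #|` B| <= #|` (A `\` B)%fset|)%N.
  by rewrite cardfsD cA leq_sub2l // fsubset_leq_card // fsubsetIr.
have [D [DAB cD Dtop]] := fset_top (fun n => modulus (es n x)) le_AB.
have DB n : n \in D -> n \in B = false.
  by move/(fsubsetP DAB); rewrite inE => /andP[/negbTE].
have dBD : [disjoint B & D]%fset.
  by apply/fdisjointP_sym => n /DB ->.
have gD : greedy_set es y (m - #|` B|) D.
  split=> // i j iD jD; rewrite !(coef_residual bio) (DB i iD).
  have [jB|jB] := boolP (j \in B); first exact: modulus0_le.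
  have [jA|jA] := boolP (j \in A).
    by apply: Dtop => //; rewrite inE jB.
  apply: Atop => //.
  by move/(fsubsetP DAB): iD; rewrite inE => /andP[].
have -> : C * (C * (2 * K)) * nrm y = C * (C * (2 * K * nrm y)) by ring.
have xBD : x - P (B `|` D)%fset x = y - P D y.
  rewrite coord_projU // opprD addrA; congr (_ - _).
  apply: eq_coord_proj => n nD.
  by rewrite (coef_residual bio) DB.
apply: le_trans (ag _ _ _ (B `|` D)%fset gA _ m0) _.
  by rewrite cardfsU_disjoint // cD subnKC.
rewrite ler_pM2l // xBD.
have [a _ [_ far]] := far_residual (m - #|` B|) 0 y.
(* Greedy approximations have positive order, so [#|` B| = m] is apart. *)
have [n0|n0] := posnP (m - #|` B|).
  have -> : D = fset0 by apply: cardfs0_eq; rewrite cD.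
  have K2 : 1 <= 2 * K by have := K_ge1; lra.
  rewrite coord_proj_eq0 ?subr0; last by move=> n; rewrite in_fset0.
  rewrite mulrA ler_peMl // mulr_ege1 //.
apply: le_trans (ag _ _ _ (block a (m - #|` B|)) gD _ n0) _.
  exact: block_card.
by rewrite ler_pM2l.
Qed.

(** * From consecutive almost greedy to almost greedy *)

Definition block_dominated (C : R) : Prop :=
  forall x m A a, (0 < m)%N -> greedy_set es x m A ->
    nrm (x - P A x) <= C * nrm (x - P (block a m) x).

Lemma consecutive_block_dominated C :
  C_consecutive_almost_greedy nrm e es C -> block_dominated C.
Proof.
move=> [C1 cag] x m A a m0 gA; apply: le_trans (cag _ _ m0 _ gA) _.
rewrite ler_pM2l; last exact: lt_le_trans C1.
apply: inf_residual_le => //; split; last exact: block_card.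
by exists a, m.
Qed.

(** This replaces democracy of the basis, and frees the hypothesis from
    intervals: [B] is scattered over the interval [J = block 0 N].  In the
    vector z that is [b] on [B] and [c] on the rest of [J] and on [D], the rest
    of [J] together with [D] is greedy and as large as [J], so that removing
    it, which leaves the part on [B], is comparable with removing [J], which
    leaves the part on [D]. *)
Lemma spread_bound (C : R) (b : nat -> scalars R s) c (B D : {fset nat}) N :
  block_dominated C -> (0 < N)%N ->
  (B `<=` block 0 N)%fset -> [disjoint block 0 N & D]%fset ->
  #|` B| = #|` D| -> (forall n, n \in B -> modulus (b n) <= modulus c) ->
  nrm (finite_sum e b B) <= C * nrm (finite_sum e (fun=> c) D).
Proof.
move=> dom N0 BN dND cBD b_le.
have BD n : n \in B -> n \in D = false.
  by move/(fsubsetP BN) => nN; apply/negbTE; move/fdisjointP: dND; apply.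
have ND n : n \in block 0 N -> n \in D = false.
  by move=> nN; apply/negbTE; move/fdisjointP: dND; apply.
set J := block 0 N in BN dND ND.
pose f n := if n \in B then b n else c.
pose G := ((J `\` B) `|` D)%fset.
pose z := finite_sum e f (J `|` D)%fset.
have dJBD : [disjoint J `\` B & D]%fset.
  by apply/fdisjointP => n; rewrite inE => /andP[_ /ND ->].
have dBG : [disjoint B & G]%fset.
  by apply/fdisjointP => n nB; rewrite !inE nB BD.
have fB : finite_sum e f B = finite_sum e b B.
  by apply: eq_big_seq => n nB; rewrite /f nB.
have fD : finite_sum e f D = finite_sum e (fun=> c) D.
  apply: eq_big_seq => n nD; rewrite /f; case: ifP => // /BD.
  by rewrite nD.
have zE n : es n z = if n \in (J `|` D)%fset then f n else 0.
  exact: coef_finite_sum.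
have sub S : (S `<=` J `|` D)%fset -> P S z = finite_sum e f S.
  move=> SJ; apply: coord_projE => n nS.
  by rewrite zE (fsubsetP SJ).
have JDE : (J `|` D = B `|` G)%fset.
  apply/fsetP => n; rewrite !in_fsetU in_fsetD.
  by have [nB|] := boolP (n \in B); rewrite ?(fsubsetP BN n nB).
have gG : greedy_set es z N G.
  split.
    rewrite /G cardfsU_disjoint // cardfsDS // -cBD subnK ?block_card //.
    by rewrite -(block_card 0 N) fsubset_leq_card.
  move=> i j iG jG; rewrite !zE !JDE.
  have iB : i \in B = false.
    by apply/negbTE; move/fdisjointP_sym: dBG; apply.
  rewrite [i \in _]in_fsetU iG orbT [j \in _]in_fsetU (negbTE jG) orbF /f iB.
  have [/b_le //|_] := boolP (j \in B); exact: modulus0_le.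
have := dom z N G 0 N0 gG.
rewrite !sub; last first.
- by rewrite JDE fsubsetUr.
- by rewrite fsubsetUl.
rewrite {1}/z JDE finite_sumU // addrK fB.
by rewrite /z finite_sumU // addrC addKr fD.
Qed.

(** The outer [K] separates P_{B-A} x, which accounts for the last summand, from
    the rest of x - P_A x, which is split once more by the inner [K].  The final
    factors [2 * K] of [C * (2 * K)] and of [2 * K * C * (2 * K)] come from
    clearing a far interval; [2 * K * C] bounds |c 1_D|. *)
Definition residual_const (C : R) : R :=
  K * (K * (C * (2 * K) + 1) + C * (2 * K * C * (2 * K))).

Lemma residual_const_ge1 C : 1 <= C -> 1 <= residual_const C.
Proof.
move=> C1; have C0 : 0 <= C by apply: le_trans C1.
have K0 := ltW K_gt0.
rewrite mulr_ege1 // ler_wpDr ?mulr_ege1 ?lerDr ?mulr_ge0 //.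
Qed.

(** Below, u = x - P_B x, D is a far interval as large as S = A-B, and v is u
    cleared on D, so that c 1_D can be added with exactly the coefficients c.
    Up to P_D u, the residual x - P_A x is (v - P_S v) + P_{B-A} x.  The first
    part is compared with v; the second with c 1_D, which is the difference of
    the greedy residuals of v + c 1_D and of v. *)
Lemma block_dominated_residual (C : R) x m A B : 1 <= C -> 
  block_dominated C -> greedy_set es x m A -> #|` B| = m ->
  nrm (x - P A x) <= residual_const C * nrm (x - P B x).
Proof.
move=> C1 dom [cA Atop] cB.
have C0 : 0 < C by exact: lt_le_trans C1.
set u := x - P B x.
pose S := (A `\` B)%fset; pose k := #|` S|.
have cBA : #|` (B `\` A)%fset| = k.
  by rewrite /k /S !cardfsD cA cB fsetIC.
have [N N0 ABN] := block_bound (A `|` B)%fset.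
have [a Na [Du_le v_le]] := far_residual k N u.
set D := block a k in Du_le v_le.
set v := u - P D u in v_le.
have disjD n : n \in (A `|` B)%fset -> n \in D = false.
  move/(fsubsetP ABN); rewrite !mem_block add0n => nN.
  by rewrite leqNgt (leq_trans nN Na).
have disjS n : n \in S -> n \in D = false.
  by rewrite inE => /andP[_ nA]; apply: disjD; rewrite inE nA.
have disjDS n : n \in D -> n \in S = false.
  by move=> nD; apply/negP => /disjS; rewrite nD.
have uE n : es n u = if n \in B then 0 else es n x by exact: coef_residual.
have vE n : es n v = if n \in D then 0 else es n u by exact: coef_residual.
have PSv : P S v = P S x.
  apply: eq_coord_proj => n nS; rewrite vE disjS // uE.
  by move: nS; rewrite inE => /andP[/negbTE ->].
have xAE : x - P A x = v - P S v + P D u + P (B `\` A)%fset x.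
  rewrite (coord_proj_swap A B) -/u -/S PSv; congr (_ + _).
  by rewrite /v [RHS]addrAC subrK.
clearbody v.
have [k0|k0] := posnP k.
  have -> : A = B.
    apply/eqP; rewrite eqEfcard cA cB leqnn andbT -fsetD_eq0.
    by apply/eqP/cardfs0_eq.
  by rewrite ler_peMl // residual_const_ge1.
have [c0 c0S c0min] : exists2 i, i \in S &
    forall j, j \in S -> modulus (es i x) <= modulus (es j x).
  have S0 : S != fset0 by rewrite -cardfs_gt0.
  have [i iS imax] := fset_argmax (fun n => - modulus (es n x)) S0.
  by exists i => // j /imax; rewrite lerN2.
set c := es c0 x in c0min.
have SA n : n \in S -> n \in A by rewrite inE => /andP[].
have c_top j : j \notin A -> modulus (es j x) <= modulus c.
  by apply: Atop; exact: SA.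
(* This covers both v and v + c 1_D. *)
have greedyS w : (forall n, n \notin D -> es n w = es n v) ->
    (forall n, n \in D -> modulus (es n w) <= modulus c) -> greedy_set es w k S.
  move=> wv wD; split=> // i j iS jS.
  rewrite [in leRHS]wv ?disjS // vE disjS // uE.
  have /negbTE -> : i \notin B by move: iS; rewrite inE => /andP[].
  apply: le_trans (c0min _ iS).
  have [/wD //|jD] := boolP (j \in D).
  rewrite wv // vE (negbTE jD) uE.
  have [jB|jB] := ifP; first exact: modulus0_le.
  by apply: c_top; apply: contra jS => jA; rewrite inE jB.
have PDv : P D v = 0.
  by apply: coord_proj_eq0 => n nD; rewrite vE nD.
have suppr : nrm (v - P S v) <= C * nrm v.
  rewrite -[in leRHS](subr0 v) -PDv; apply: dom => //.
  apply: greedyS => // n nD; rewrite vE nD; exact: modulus0_le.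
pose h := finite_sum e (fun=> c) D.
have hE n : es n h = if n \in D then c else 0 by exact: coef_finite_sum.
have swap : nrm (v - P S v + h) <= C * nrm v.
  have -> : v - P S v + h = (v + h) - P S (v + h).
    rewrite (@eq_coord_proj _ _ _ _ S (v + h) v) 1?addrAC // => n nS.
    by rewrite coefD hE disjS // addr0.
  have {3}-> : v = (v + h) - P D (v + h).
    rewrite (@coord_projE _ _ e es D (v + h) (fun=> c)) ?addrK // => n nD.
    by rewrite coefD hE vE nD add0r.
  apply: dom => //; apply: greedyS => n nD.
    by rewrite coefD hE (negbTE nD) addr0.
  by rewrite coefD hE vE nD add0r.
have h_le : nrm h <= 2 * K * C * nrm v.
  have -> : h = (v - P S v + h) - (v - P S v) by rewrite addrAC subrr add0r.
  apply: le_trans (nrmB _ _) _.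
  have -> : 2 * K * C * nrm v = K * (C * nrm v + C * nrm v) by ring.
  by rewrite ler_pM2l // lerD.
have spread : nrm (P (B `\` A)%fset x) <= C * nrm h.
  apply: (@spread_bound C (fun n => es n x) c _ D N) => //.
  - apply: fsubset_trans ABN; apply: fsubset_trans (fsubsetDl _ _) _.
    exact: fsubsetUr.
  - apply/fdisjointP => n; rewrite !mem_block add0n => nN.
    by rewrite leqNgt (leq_trans nN Na).
  - by rewrite cBA block_card.
  - by move=> n; rewrite inE => /andP[nA _]; exact: c_top.
rewrite xAE /residual_const -mulrA; apply: le_trans (nrmD _ _) _.
rewrite ler_pM2l // [leRHS]mulrDl; apply: lerD.
  apply: le_trans (nrmD _ _) _; rewrite -mulrA ler_pM2l // mulrDl mul1r.
  apply: lerD => //; apply: le_trans suppr _.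
  by rewrite -mulrA ler_pM2l.
apply: le_trans spread _; rewrite -mulrA ler_pM2l //.
apply: le_trans h_le _; rewrite -[leRHS]mulrA ler_pM2l //.
by rewrite !mulr_gt0.
Qed.

(** Induction on the number of elements of [A] outside [B].  With a largest
    coefficient [a] on [A] minus [B] and any [b] in [B] minus [A], the vector
    [w = x - P (B `\ b) x] has the greedy set {a}: elsewhere its coefficients
    are 0, lie on [A] minus [B], or lie outside [A].  Comparing {a} with the
    interval {b} shows that exchanging [b] for [a] does not increase the
    residual. *)
Lemma isometric_residual x m A B : block_dominated 1 ->
  greedy_set es x m A -> #|` B| = m -> nrm (x - P A x) <= nrm (x - P B x).
Proof.
move=> dom gA; have [cA Atop] := gA.
move nk : #|` (A `\` B)%fset| => k.
elim: k B nk => [|k IH] B nk cB.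
  suff -> : A = B by [].
  apply/eqP; rewrite eqEfcard cA cB leqnn andbT -fsetD_eq0.
  by apply/eqP/cardfs0_eq.
have cBA : #|` (B `\` A)%fset| = k.+1.
  by rewrite -nk !cardfsD cA cB fsetIC.
have AB0 : (A `\` B)%fset != fset0 by rewrite -cardfs_gt0 nk.
have [a aAB amax] := fset_argmax (fun n => modulus (es n x)) AB0.
have /fset0Pn[b bBA] : (B `\` A)%fset != fset0 by rewrite -cardfs_gt0 cBA.
move: aAB bBA; rewrite !inE => /andP[aB aA] /andP[bA bB].
pose B0 := (B `\ b)%fset; pose B' := (a |` B0)%fset.
have aB0 : a \notin B0 by rewrite !inE negb_and aB orbT.
have bB0 : b \notin B0 by rewrite !inE eqxx.
have BE : B = (b |` B0)%fset by rewrite fsetD1K.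
have cB' : #|` B'| = m.
  by rewrite -cB BE !cardfsU1 aB0 bB0.
have AB'E : (A `\` B' = (A `\` B) `\ a)%fset.
  apply/fsetP => n; rewrite !inE.
  have [-> //|na /=] := eqVneq n a.
  have [->|nb //=] := eqVneq n b; first by rewrite (negbTE bA) !andbF.
apply: le_trans (IH B' _ cB') _.
  rewrite AB'E; apply: succn_inj; rewrite -nk (cardfsD1 a (A `\` B)%fset).
  by rewrite !inE aB aA.
pose w := x - P B0 x.
have wE n : es n w = if n \in B0 then 0 else es n x by exact: coef_residual.
have step i : i \notin B0 -> x - P (i |` B0)%fset x = w - P [fset i]%fset w.
  move=> iB0; rewrite coord_projU ?fdisjoint1X // [P [fset i]%fset x + _]addrC.
  rewrite opprD addrA; congr (_ - _).
  by apply: eq_coord_proj => n; rewrite inE => /eqP ->; rewrite wE (negbTE iB0).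
rewrite {1}BE !step // -[leRHS]mul1r.
have -> : ([fset b] = block b 1)%fset.
  by apply/fsetP => n; rewrite mem_block inE addn1 ltnS eqn_leq andbC.
apply: dom => //; split=> [|i j]; first by rewrite cardfs1.
rewrite inE => /eqP -> {i}; rewrite inE => ja.
rewrite !wE (negbTE aB0); have [jB0|jB0] := ifP.
  exact: modulus0_le.
have [jA|jA] := boolP (j \in A); last exact: Atop.
have [jB|jB] := boolP (j \in B); last by apply: amax; rewrite inE jB.
suff jb : j = b by rewrite jb (negbTE bA) in jA.
by apply/eqP; move: jB0; rewrite !inE jB andbT => /negbFE.
Qed.

End Basis.

Theorem theorem2p8 (R : realType) (s : scalar_kind) (p : R)
    (hp0 : 0 < p) (hp1 : p <= 1)
    (X : lmodType (scalars R s)) (nrm : X -> R) (hX : p_Banach p nrm)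
    (e : nat -> X) (es : nat -> {scalar X}) (hB : is_basis nrm e es) :
  let uniform_bound : Prop :=
    exists C : R, 1 <= C /\
      forall (x : X) (m : nat), (0 < m)%N ->
      forall A : {fset nat}, greedy_set es x m A ->
      forall k : nat, (k <= m)%N ->
        nrm (x - coord_proj e es A x) <= C * sigma_check nrm e es k x in
  [/\ almost_greedy nrm e es <-> uniform_bound,
      uniform_bound <-> consecutive_almost_greedy nrm e es
    & p = 1 -> C_consecutive_almost_greedy nrm e es 1 ->
      C_almost_greedy nrm e es 1].
Proof.
move=> uniform_bound; have hN := p_Banach_norm hX.
have K1 : 1 <= 2 `^ p^-1 :> R.
  by rewrite -[leLHS](powRr0 2) ler_powR ?ler1n // invr_ge0 ltW.
have ag_ub : almost_greedy nrm e es -> uniform_bound.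
  move=> [C agC]; have C1 : 1 <= C := agC.1.
  set K := 2 `^ p^-1 in K1.
  have C'1 : 1 <= C * (C * (2 * K)) by nra.
  exists (C * (C * (2 * K))); split=> // x m m0 A gA k km.
  apply: (@le_inf_residual _ _ _ _ _ _ _ [fset i | i in iota 0 k]%fset).
  - exact: lt_le_trans C'1.
  - by split; [exists 0%N, k | exact: block_card].
  - move=> B [_ cB].
    by apply: (almost_greedy_residual hp0 hN hB agC m0 gA); rewrite cB.
have ub_cag : uniform_bound -> consecutive_almost_greedy nrm e es.
  move=> [C [C1 ub]]; exists C; split=> // x m m0 A gA.
  exact: (ub x m m0 A gA m (leqnn m)).
have cag_ag : consecutive_almost_greedy nrm e es -> almost_greedy nrm e es.
  move=> [C cagC]; have C1 : 1 <= C := cagC.1.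
  have dom := consecutive_block_dominated hN cagC.
  have C'1 := residual_const_ge1 hp0 C1.
  exists (residual_const p C); split=> // x m m0 A gA.
  apply: (@le_inf_residual _ _ _ _ _ _ _ [fset i | i in iota 0 m]%fset).
  - exact: lt_le_trans C'1.
  - exact: block_card.
  - by move=> B cB; exact: (block_dominated_residual hp0 hN hB C1 dom gA cB).
split; [by split=> [|/ub_cag/cag_ag] | by split=> [|/cag_ag/ag_ub] |].
move=> _ cag1; split=> // x m m0 A gA.
have dom := consecutive_block_dominated hN cag1.
apply: (@le_inf_residual _ _ _ _ _ _ _ [fset i | i in iota 0 m]%fset) => //.
  exact: block_card.
move=> B cB; rewrite mul1r.
exact: (isometric_residual hB dom gA cB).
Qed.
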